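(* Let $A,\hat A\in[0,1]^{N\times N}$ be fixed (deterministic) adjacency matrices. Let $\{(Z_A^{(i)},Z_{\hat A}^{(i)})\}_{i=0}^{L}$ be random matrices on a common probability space, with all randomness coming from a shared random input $X$: $Z_A^{(0)}=Z_{\hat A}^{(0)}=X$, and for $i=0,1,\dots,L-1$ $$Z_A^{(i+1)}=T_A^{(i)}(Z_A^{(i)}),\qquad Z_{\hat A}^{(i+1)}=T_{\hat A}^{(i)}(Z_{\hat A}^{(i)}),$$ where $T_A^{(i)}(z)=\rho\bigl(\psi(A)\,z\,\theta^{(i)}\bigr)$ and $T_{\hat A}^{(i)}(z)=\rho\bigl(\psi(\hat A)\,z\,\theta^{(i)}\bigr)$. Assume $H(X)<\infty$, so that $I(Z_A^{(0)};Z_{\hat A}^{(0)})=H(X)$ is finite. Then $I(Z_A^{(i)};Z_{\hat A}^{(i)})$ is finite for all $i=0,\dots,L$, and for every $i=0,\dots,L-1$, $$I\bigl(Z_A^{(i+1)};Z_{\hat A}^{(i+1)}\bigr)\le I\bigl(Z_A^{(i)};Z_{\hat A}^{(i)}\bigr).$$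
   Context: $X$ is a random matrix in $\mathbb{R}^{N\times D}$. Each $\theta^{(i)}\in\mathbb{R}^{d_i\times d_{i+1}}$ (with $d_0=D$) is a fixed weight matrix; $\psi$ is a fixed map assigning to an adjacency matrix a matrix in $\mathbb{R}^{N\times N}$ (acting by left multiplication; e.g. the normalized adjacency in a graph convolutional network); $\rho$ is a fixed (Borel measurable) activation function $\mathbb{R}\to\mathbb{R}$ applied componentwise. $I(U;V)$ denotes mutual information (the KL divergence of the joint law from the product of the marginals), $H$ denotes entropy, with $H(X)=I(X;X)$; natural logarithms are used. *)

(* Defs.v *)
From HB Require Import structures.
From mathcomp Require Import all_boot all_order all_algebra.
From mathcomp Require Import all_classical all_reals all_analysis.

Set Implicit Arguments.
Unset Strict Implicit.
Unset Printing Implicit Defensive.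

Import Order.TTheory GRing.Theory Num.Theory.
Import numFieldNormedType.Exports.

Local Open Scope classical_set_scope.
Local Open Scope ring_scope.

(* 'M[T]_(m, n) carries the product sigma-algebra, i.e. the smallest one making
   all entries M |-> M i j measurable; for T = R (with its Borel sets) this is
   the Borel sigma-algebra of R^(m x n). *)
Definition measure_mx_display : measure_display -> measure_display.
Proof. exact. Qed.

Section measurable_matrix.
Context {d : measure_display} {T : measurableType d}.
Variables m n : nat.

Definition mx_measurable : set (set 'M[T]_(m, n)) :=
  <<s \bigcup_(ij in [set: 'I_m * 'I_n])
        preimage_set_system setT (fun M : 'M[T]_(m, n) => M ij.1 ij.2)
          measurable >>.

Let mx_measurable0 : mx_measurable set0.
Proof. exact: sigma_algebra0. Qed.

Let mx_measurableC A : mx_measurable A -> mx_measurable (~` A).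
Proof. exact: sigma_algebraC. Qed.

Let mx_measurable_bigcup (F : (set 'M[T]_(m, n))^nat) :
  (forall i, mx_measurable (F i)) -> mx_measurable (\bigcup_i F i).
Proof. exact: sigma_algebra_bigcup. Qed.

HB.instance Definition _ := @isMeasurable.Build (measure_mx_display d)
  'M[T]_(m, n) mx_measurable mx_measurable0 mx_measurableC mx_measurable_bigcup.

End measurable_matrix.

Section mutual_information.
Local Open Scope ereal_scope.
Local Open Scope charge_scope.

Definition kl_divergence (d : measure_display) (T : measurableType d)
    (R : realType) (P Q : probability T R) : \bar R :=
  if `[< P `<< Q >]
  then \int[P]_x lne (('d (charge_of_finite_measure P) '/d Q) x)
  else +oo.

Context {d d1 d2 : measure_display} {Omega : measurableType d}
  {T1 : measurableType d1} {T2 : measurableType d2} {R : realType}.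
Variable P : probability Omega R.

Definition pair_RV (U : {RV P >-> T1}) (V : {RV P >-> T2}) (w : Omega) :
  T1 * T2 := (U w, V w).

Let measurable_pair_RV (U : {RV P >-> T1}) (V : {RV P >-> T2}) :
  measurable_fun setT (pair_RV U V).
Proof. exact: measurable_fun_pair. Qed.

HB.instance Definition _ (U : {RV P >-> T1}) (V : {RV P >-> T2}) :=
  isMeasurableFun.Build _ _ _ _ (pair_RV U V) (measurable_pair_RV U V).

Definition mutual_information (U : {RV P >-> T1}) (V : {RV P >-> T2}) :
    \bar R :=
  kl_divergence (distribution P (pair_RV U V))
    (distribution P U \x distribution P V).

End mutual_information.

(* H(X) = I(X; X): for a random matrix X with purely atomic law this is the
   Shannon entropy in nats; otherwise it is +oo. *)
Definition entropy (d d1 : measure_display) (Omega : measurableType d)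
    (T1 : measurableType d1) (R : realType) (P : probability Omega R)
    (X : {RV P >-> T1}) : \bar R :=
  mutual_information X X.

Definition gnn_layer (R : realType) (N p q : nat) (rho : R -> R)
    (psiA : 'M[R]_N) (theta : 'M[R]_(p, q)) (z : 'M[R]_(N, p)) : 'M[R]_(N, q) :=
  map_mx rho (psiA *m z *m theta).

(* Main.v *)
From HB Require Import structures.
Require Import Defs.
From mathcomp Require Import all_boot all_order all_algebra.
From mathcomp Require Import all_classical all_reals all_analysis.
From mathcomp Require Import measurable_realfun lra.

(* Mutual information is a Kullback-Leibler divergence, so the theorem is the
   data processing inequality for the map [(z, z') |-> (T_A z, T_Ahat z')],
   which sends the joint law to the joint law and the product of the marginals
   to the product of the marginals. If [phi = dP/dQ] and [g] is the density of
   the image measures under [t], then [ln u <= u - 1] gives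
     [int_P (ln (g \o t) - ln phi) <= int_P (g \o t) / phi - 1
        <= int_Q (g \o t) - 1 = 0].
   Nonnegativity of the divergence is the same inequality with [g = 1]. *)

Set Implicit Arguments.
Unset Strict Implicit.
Unset Printing Implicit Defensive.

Import Order.TTheory GRing.Theory Num.Theory.
Import numFieldNormedType.Exports.

Local Open Scope classical_set_scope.
Local Open Scope ring_scope.

(** * Transport of mutual information and of integrals *)

Lemma mutual_information_eq (d d1 d2 : measure_display)
    (Omega : measurableType d) (T1 : measurableType d1)
    (T2 : measurableType d2) (R : realType) (P : probability Omega R)
    (U U' : {RV P >-> T1}) (V V' : {RV P >-> T2}) :
  U =1 U' -> V =1 V' -> mutual_information U V = mutual_information U' V'.
Proof. by move=> /mfuneqP -> /mfuneqP ->. Qed.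

(** No integrability of [f] is required, because its positive and negative parts transport
    separately. [P'] need only agree with the image measure on measurable sets, so it may be given
    as a product of marginals. *)
Lemma integral_image_measure (d d' : measure_display)
    (T : measurableType d) (T' : measurableType d') (R : realType)
    (P : {measure set T -> \bar R}) (P' : {measure set T' -> \bar R})
    (t : T -> T') (f : T' -> \bar R) :
  measurable_fun setT t -> measurable_fun setT f ->
  (forall A, measurable A -> P' A = P (t @^-1` A)) ->
  (\int[P']_y f y = \int[P]_x f (t x))%E.
Proof.
move=> mt mf PE.
have ge0 g : measurable_fun setT g -> (forall y, 0 <= g y)%E ->
    (\int[P']_y g y = \int[P]_x g (t x))%E.
  move=> mg g0.
  rewrite -[RHS](@ge0_integral_pushforward _ _ _ _ _ _ mt P setT)//.
  by apply: eq_measure_integral => A mA _; rewrite PE.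
rewrite integralE [RHS]integralE; congr (_ - _)%E.
  rewrite (funepos_comp f t).
  exact: (ge0 (f^\+)%E (measurable_funepos mf) (funepos_ge0 f)).
rewrite (funeneg_comp f t).
exact: (ge0 (f^\-)%E (measurable_funeneg mf) (funeneg_ge0 f)).
Qed.

(** * Densities and comparison of logarithms *)

Lemma measurable_fun_lne (R : realType) (d : measure_display)
    (T : measurableType d) (f : T -> \bar R) :
  (forall x, f x \is a fin_num) -> measurable_fun setT f ->
  measurable_fun setT (fun x => lne (f x)).
Proof.
move=> ffin mf.
have mg : measurable_fun setT (fun x => fine (f x)).
  by apply: measurableT_comp mf => //; exact: fine_measurable.
rewrite (_ : (fun x => _) = fun x =>
    if fine (f x) <= 0 then -oo%E else (ln (fine (f x)))%:E).
  apply: measurable_fun_ifT => //.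
    exact: measurable_fun_ler.
  by apply/measurable_EFinP; exact: measurableT_comp mg.
by apply/funext => x; rewrite -{1}(fineK (ffin x)).
Qed.

(* As [ln 0 = 0], [expR (- ln phi)] is [1 / phi] where [phi > 0] but [1] where
   [phi = 0]; the bound is not an equality because [Q] may charge
   [phi = 0]. *)
Lemma kl_divergence_density (d : measure_display) (T : measurableType d)
    (R : realType) (P Q : probability T R) : P `<< Q ->
  exists2 phi : T -> R,
    [/\ measurable_fun setT phi, (forall x, 0 <= phi x),
    (\int[Q]_x (phi x)%:E = 1)%E,
    (forall f : T -> \bar R, (forall x, 0 <= f x)%E -> measurable_fun setT f ->
       (\int[P]_x (f x * (expR (- ln (phi x)))%:E) <= \int[Q]_x f x)%E) &
    {ae P, forall x, 0 < phi x}] &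
    (kl_divergence P Q = \int[P]_x (ln (phi x))%:E)%E.
Proof.
move=> PQ.
(* This version of the density is nonnegative and finite at every point; it is matched almost
   everywhere with the derivative in [kl_divergence] at the end. *)
pose F := Radon_Nikodym_SigmaFinite.f P Q.
have F0 x : (0 <= F x)%E by exact: Radon_Nikodym_SigmaFinite.f_ge0.
have Ffin x : F x \is a fin_num by exact: Radon_Nikodym_SigmaFinite.f_fin_num.
have mF : measurable_fun setT F.
  exact: measurable_int (Radon_Nikodym_SigmaFinite.f_integrable PQ).
have mphi : measurable_fun setT (fun x => fine (F x)).
  exact: (measurableT_comp (fine_measurable measurableT) mF).
have phi0 x : 0 <= fine (F x) by rewrite fine_ge0.
have phipos : {ae P, forall x, 0 < fine (F x)}.
  have mZ : measurable [set x | fine (F x) = 0].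
    by rewrite -[X in measurable X]setTI; exact: (mphi measurableT [set 0]).
  exists [set x | fine (F x) = 0]; split=> //.
  (* The [P]-mass of the zero set is the [Q]-integral of [F] over it. *)
  - rewrite (Radon_Nikodym_SigmaFinite.f_integral PQ)//.
    rewrite integral0_eq// => x /= Fx.
    by rewrite -/F -(fineK (Ffin x)) Fx.
  - move=> x /= /negP; rewrite -leNgt => Fx.
    by apply/eqP; rewrite eq_le Fx phi0.
exists (fun x => fine (F x)).
- split=> //.
    under eq_integral do rewrite fineK//.
    rewrite -(Radon_Nikodym_SigmaFinite.f_integral PQ)//.
    exact: probability_setT.
  move=> f f0 mf.
  have mexpln : measurable_fun setT (fun x => (expR (- ln (fine (F x))))%:E).
    by apply/measurable_EFinP; do 3 (apply: measurableT_comp => //).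
  have fexp0 x : (0 <= f x * (expR (- ln (fine (F x))))%:E)%E.
    by rewrite mule_ge0// lee_fin expR_ge0.
  (* Over [Q] the integrand gains a factor [F], which cancels [expR (- ln F)] where [F > 0] and
     annihilates the integrand where [F = 0]. *)
  rewrite -(Radon_Nikodym_SigmaFinite.change_of_variables PQ)//; last first.
    exact: emeasurable_funM.
  apply: ge0_le_integral => // [x _||x _].
  + by rewrite mule_ge0.
  + by apply: emeasurable_funM => //; exact: emeasurable_funM.
  + rewrite -muleA -[leRHS]mule1 lee_wpmul2l// -/F -{2}(fineK (Ffin x)).
    rewrite -EFinM lee_fin.
    have := phi0 x; rewrite le_eqVlt => /predU1P[<-|Fx]; first by rewrite mulr0.
    by rewrite expRN lnK ?posrE// mulVf// gt_eqF.
- rewrite /kl_divergence; case: asboolP => // _.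
  have PQc : charge_of_finite_measure P `<< Q by [].
  apply: ae_eq_integral => //.
  + apply: measurable_fun_lne.
      by move=> x; exact: Radon_Nikodym_fin_num.
    exact: measurable_int (Radon_Nikodym_integrable PQc).
  + by apply/measurable_EFinP; exact: measurableT_comp mphi.
  (* The two versions of the density agree [Q]-a.e., hence [P]-a.e.; positivity then identifies
     [lne] with [ln], which differ at 0. *)
  + have := null_dominates_ae_eq measurableT PQ
      (ae_eq_Radon_Nikodym_SigmaFinite PQ measurableT).
    apply: filterS2 phipos => x Fx /(_ I) <- _.
    by rewrite -/F -{1}(fineK (Ffin x)) lne_EFin.
Qed.

(* By [1 + u <= expR u] at [u = b - a]; the bounds on [expR (- a)] and
   [expR (- b)] control the negative parts. *)
Lemma le_integral_expRB (d : measure_display) (T : measurableType d)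
    (R : realType) (P : probability T R) (a b : T -> R) :
  measurable_fun setT a -> measurable_fun setT b ->
  (\int[P]_x (expR (- a x))%:E <= 1)%E ->
  (\int[P]_x (expR (- b x))%:E <= 1)%E ->
  (\int[P]_x (expR (b x - a x))%:E <= 1)%E ->
  (\int[P]_x (b x)%:E <= \int[P]_x (a x)%:E)%E.
Proof.
move=> ma mb ea eb eba.
have mexp (f : T -> R) : measurable_fun setT f ->
    measurable_fun setT (fun x => expR (f x)).
  by move=> mf; exact: measurableT_comp mf.
have iexp (f : T -> R) : measurable_fun setT f ->
    (\int[P]_x (expR (f x))%:E <= 1)%E ->
    P.-integrable setT (fun x => (expR (f x))%:E).
  move=> mf ef; apply/integrableP; split.
    by apply/measurable_EFinP; exact: mexp.
  apply: le_lt_trans (ltry 1); apply: le_trans ef.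
  by under eq_integral do rewrite gee0_abs ?lee_fin ?expR_ge0//.
have mNa : measurable_fun setT (fun x => - a x) by exact: measurableT_comp ma.
have mNb : measurable_fun setT (fun x => - b x) by exact: measurableT_comp mb.
have mba : measurable_fun setT (fun x => b x - a x) by exact: measurable_funB.
have [->|aoo] := eqVneq (\int[P]_x (a x)%:E)%E +oo%E; first exact: leey.
have ia : P.-integrable setT (EFin \o a).
  have mEa : measurable_fun setT (EFin \o a) by exact/measurable_EFinP.
  (* The negative part of [a] is at most [expR (- a)]. Being integrable, it forces the positive part
     to be integrable too, as the integral of [a] is not [+oo]. *)
  have inega : P.-integrable setT ((EFin \o a)^\-)%E.
    apply: le_integrable (iexp _ mNa ea) => //; first exact: measurable_funeneg.
    move=> x _; rewrite gee0_abs ?funeneg_ge0// gee0_abs ?lee_fin ?expR_ge0//.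
    rewrite funenegE /= -EFin_max lee_fin ge_max expR_ge0 andbT.
    by have := expR_ge1Dx (- a x); lra.
  have iposa : P.-integrable setT ((EFin \o a)^\+)%E.
    apply/integrableP; split; first exact: measurable_funepos.
    under eq_integral do rewrite gee0_abs ?funepos_ge0//.
    rewrite ltey; apply: contra_neq aoo => pos_oo.
    rewrite integralE pos_oo addye// eqe_oppLR.
    have := integrable_fin_num measurableT inega.
    by case: integral.
  rewrite (funeposneg (EFin \o a)); exact: integrableB.
have ib : P.-integrable setT (EFin \o b).
  (* This dominates [b] from both sides: [b <= a + expR (b - a)] and [- b <= expR (- b)]. *)
  have iS : P.-integrable setT (fun x => `|(a x)%:E| +
      ((expR (b x - a x))%:E + (expR (- b x))%:E))%E.
    apply: integrableD => //; first exact: integrable_abse.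
    by apply: integrableD => //; exact: iexp.
  apply: le_integrable iS => //; first exact/measurable_EFinP.
  move=> x _; rewrite -!EFinD /= lee_fin.
  have := expR_ge1Dx (b x - a x); have := expR_ge1Dx (- b x).
  have := ler_norm (a x); have := expR_ge0 (b x - a x).
  have := expR_ge0 (- b x); have := normr_ge0 (a x).
  have := ler_norm (`|a x| + (expR (b x - a x) + expR (- b x))).
  by rewrite ler_norml; lra.
rewrite -sube_le0 -?integralB_EFin//.
apply: (@le_trans _ _ (\int[P]_x ((expR (b x - a x))%:E - 1%:E))%E).
  apply: le_integral => //.
  - exact: integrableB ib ia.
  - by apply: integrableB; [|exact: iexp|exact: finite_measure_integrable_cst].
  - by move=> x _; rewrite -!EFinB lee_fin; have := expR_ge1Dx (b x - a x); lra.
rewrite integralB//; [|exact: iexp|exact: finite_measure_integrable_cst].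
by rewrite integral_cst// [X in (_ * X)%E]probability_setT mul1e sube_le0.
Qed.

(** The case [f = 1] of the density bound; it provides the control of negative parts that
    [le_integral_expRB] asks for. *)
Lemma integral_expRN_ln_le1 (d : measure_display) (T : measurableType d)
    (R : realType) (P Q : probability T R) (phi : T -> R) :
  (forall f : T -> \bar R, (forall x, 0 <= f x)%E -> measurable_fun setT f ->
     (\int[P]_x (f x * (expR (- ln (phi x)))%:E) <= \int[Q]_x f x)%E) ->
  (\int[P]_x (expR (- ln (phi x)))%:E <= 1)%E.
Proof.
move=> /(_ (cst 1%E) (fun=> lee01) (measurable_cst _)).
rewrite integral_cst// [X in (_ * X)%E]probability_setT mul1e.
by under eq_integral do rewrite mul1e.
Qed.

(** * Nonnegativity and data processing for the divergence *)

Lemma kl_divergence_ge0 (d : measure_display) (T : measurableType d)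
    (R : realType) (P Q : probability T R) : (0 <= kl_divergence P Q)%E.
Proof.
have [PQ|nPQ] := asboolP (P `<< Q); last first.
  by rewrite /kl_divergence; case: asboolP.
have [phi [mphi phi0 phi1 chg phipos] ->] := kl_divergence_density PQ.
have mln : measurable_fun setT (fun x => ln (phi x)).
  exact: measurableT_comp mphi.
have e1 : (\int[P]_x (expR (- ln (phi x)))%:E <= 1)%E.
  exact: integral_expRN_ln_le1 chg.
have := @le_integral_expRB _ _ _ P (fun x => ln (phi x)) (cst 0).
rewrite /= integral0; apply=> //.
- by rewrite oppr0 expR0 integral_cst// [X in (_ * X)%E]probability_setT mul1e.
- by under eq_integral do rewrite /= sub0r.
Qed.

Lemma kl_divergence_pushforward (d d' : measure_display)
    (T : measurableType d) (T' : measurableType d') (R : realType)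
    (P Q : probability T R) (P' Q' : probability T' R) (t : T -> T') :
  measurable_fun setT t ->
  (forall A, measurable A -> P' A = P (t @^-1` A)) ->
  (forall A, measurable A -> Q' A = Q (t @^-1` A)) ->
  (kl_divergence P' Q' <= kl_divergence P Q)%E.
Proof.
move=> mt P'E Q'E.
have [PQ|nPQ] := asboolP (P `<< Q); last first.
  by rewrite [leRHS]/kl_divergence; case: asboolP => // _; exact: leey.
have PQ' : P' `<< Q'.
  apply/null_content_dominatesP => A mA QA; rewrite P'E//.
  move/null_content_dominatesP : PQ; apply=> //.
    by rewrite -[X in measurable X]setTI; exact: mt.
  exact: etrans (esym (Q'E _ mA)) QA.
have [phi [mphi phi0 phi1 chg phipos] ->] := kl_divergence_density PQ.
have [g [mg g0 g1 chg' gpos] ->] := kl_divergence_density PQ'.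
have mlng : measurable_fun setT (fun y => ln (g y)).
  exact: measurableT_comp mg.
rewrite (integral_image_measure mt _ P'E); last exact/measurable_EFinP.
have mlnphi : measurable_fun setT (fun x => ln (phi x)).
  exact: measurableT_comp mphi.
have gpost : {ae P, forall x, 0 < g (t x)}.
  case: gpos => A [mA A0 subA]; exists (t @^-1` A); split.
  - by rewrite -[X in measurable X]setTI; exact: mt.
  - exact: etrans (esym (P'E _ mA)) A0.
  - by move=> x /subA.
(* Here [a] is [ln phi] and [b] is [ln (g \o t)]. *)
apply: le_integral_expRB => //.
- exact: (measurableT_comp mlng mt).
- exact: integral_expRN_ln_le1 chg.
- rewrite -(@integral_image_measure _ _ _ _ _ P P' t
    (fun y => (expR (- ln (g y)))%:E))//.
    exact: integral_expRN_ln_le1 chg'.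
  by apply/measurable_EFinP; do 2 (apply: measurableT_comp => //).
- apply: (@le_trans _ _ (\int[P]_x
      ((g (t x))%:E * (expR (- ln (phi x)))%:E))%E).
    (* The comparison is only almost everywhere: where [g (t x) = 0], [expR (ln (g (t x)))] is 1 and
       not 0. *)
    apply: ae_ge0_le_integral => //.
    + apply/measurable_EFinP; apply: (measurableT_comp (@measurable_expR R)).
      by apply: measurable_funB => //; exact: (measurableT_comp mlng mt).
    + by move=> x _; rewrite mule_ge0// lee_fin ?expR_ge0.
    + apply: emeasurable_funM; apply/measurable_EFinP.
        exact: (measurableT_comp mg mt).
      by do 2 (apply: measurableT_comp => //).
    + apply: filterS gpost => x gx _.
      by rewrite -EFinM lee_fin expRD lnK ?posrE.
  apply: (@le_trans _ _ (\int[Q]_x (g (t x))%:E)%E).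
    apply: chg => //; first by move=> x; rewrite lee_fin.
    apply/measurable_EFinP; exact: (measurableT_comp mg mt).
  (* Back on the image space, [g] is a density with respect to [Q'], of total mass 1. *)
  rewrite -(@integral_image_measure _ _ _ _ _ Q Q' t (fun y => (g y)%:E))//.
    by rewrite g1.
  exact/measurable_EFinP.
Qed.

(** * Data processing for mutual information *)

Lemma mutual_information_comp_le (d d1 d2 d1' d2' : measure_display)
    (Omega : measurableType d) (T1 : measurableType d1)
    (T2 : measurableType d2) (T1' : measurableType d1')
    (T2' : measurableType d2') (R : realType) (P : probability Omega R)
    (U : {RV P >-> T1}) (V : {RV P >-> T2})
    (U' : {RV P >-> T1'}) (V' : {RV P >-> T2'})
    (s : T1 -> T1') (t : T2 -> T2') :
  measurable_fun setT s -> measurable_fun setT t ->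
  U' =1 s \o U -> V' =1 t \o V ->
  (mutual_information U' V' <= mutual_information U V)%E.
Proof.
move=> ms mt U'E V'E.
have mst : measurable_fun setT (fun z : T1 * T2 => (s z.1, t z.2)).
  by apply: measurable_fun_pair; exact: measurableT_comp.
apply: (kl_divergence_pushforward mst) => A mA.
  rewrite /distribution /pushforward /=; congr (P _).
  by apply/seteqP; split=> w /=; rewrite /pair_RV U'E V'E.
pose st : {mfun (T1 * T2)%type >-> (T1' * T2')%type} :=
  HB.pack (fun z : T1 * T2 => (s z.1, t z.2))
    (isMeasurableFun.Build _ _ _ _ _ mst).
have sS B : measurable B -> measurable (s @^-1` B).
  by move=> mB; rewrite -[X in measurable X]setTI; exact: ms.
have tS B : measurable B -> measurable (t @^-1` B).
  by move=> mB; rewrite -[X in measurable X]setTI; exact: mt.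
pose Q : probability _ R := (distribution P U \x distribution P V)%E.
(* The map acts on each coordinate separately, so preimages of rectangles are rectangles; agreement
   there determines the product measure. *)
apply: (@product_measure_unique _ _ _ _ _
  (distribution P U') (distribution P V') (distribution Q st)) => // B C mB mC.
rewrite [LHS](_ : _ = (distribution P U \x distribution P V)%E
  ((s @^-1` B) `*` (t @^-1` C)))//.
rewrite product_measure1E; [|exact: sS|exact: tS].
by congr (P _ * P _)%E; apply/seteqP; split=> w /=; rewrite ?U'E ?V'E.
Qed.

(** * Measurability of the layers *)

Lemma measurable_mx_entry (d : measure_display) (T : measurableType d)
    (m n : nat) (i : 'I_m) (j : 'I_n) :
  measurable_fun setT (fun M : 'M[T]_(m, n) => M i j).
Proof.
move=> _ B mB; apply: sub_sigma_algebra.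
by exists (i, j) => //; exists B.
Qed.

(** The entry preimages generate the sigma-algebra on matrices, so it suffices to test these. *)
Lemma measurable_fun_mx (d d' : measure_display) (S : measurableType d)
    (T : measurableType d') (m n : nat) (f : S -> 'M[T]_(m, n)) :
  (forall i j, measurable_fun setT (fun x => f x i j)) ->
  measurable_fun setT f.
Proof.
move=> mf; apply: (measurability
  (\bigcup_(ij in [set: 'I_m * 'I_n])
     preimage_set_system setT (fun M : 'M[T]_(m, n) => M ij.1 ij.2)
       measurable)) => // _ [_ [[i j] _ [B mB <-]] <-].
by rewrite setTI; exact: mf.
Qed.

Lemma measurable_gnn_layer (R : realType) (N p q : nat) (rho : R -> R)
    (A : 'M[R]_N) (theta : 'M[R]_(p, q)) :
  measurable_fun setT rho -> measurable_fun setT (gnn_layer rho A theta).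
Proof.
move=> mrho; apply: measurable_fun_mx => i j.
(* Each output entry is [rho] of a linear form in the entries of [z]. *)
rewrite (_ : (fun x => _) = rho \o (fun z : 'M[R]_(N, p) =>
  \sum_k (\sum_l A i l * z l k) * theta k j)); last first.
  apply/funext => z; rewrite /gnn_layer !mxE /=; congr rho.
  by apply: eq_bigr => k _; rewrite mxE.
apply: measurableT_comp => //; apply: measurable_sum => k.
apply: measurable_funM => //; apply: measurable_sum => l.
by apply: measurable_funM => //; exact: measurable_mx_entry.
Qed.

Theorem theorem8 (R : realType) (dO : measure_display)
    (Omega : measurableType dO) (P : probability Omega R)
    (N L : nat) (d : nat -> nat)
    (A Ahat : 'M[R]_N)
    (hA : forall i j, 0 <= A i j <= 1)
    (hAhat : forall i j, 0 <= Ahat i j <= 1)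
    (psi : 'M[R]_N -> 'M[R]_N)
    (rho : R -> R) (mrho : measurable_fun [set: R] rho)
    (theta : forall i : nat, 'M[R]_(d i, d i.+1))
    (X : {RV P >-> 'M[R]_(N, d 0%N)})
    (ZA ZAhat : forall i : nat, {RV P >-> 'M[R]_(N, d i)})
    (hZA0 : forall w, ZA 0%N w = X w)
    (hZAhat0 : forall w, ZAhat 0%N w = X w)
    (hZA : forall i w, (i < L)%N ->
      ZA i.+1 w = gnn_layer rho (psi A) (theta i) (ZA i w))
    (hZAhat : forall i w, (i < L)%N ->
      ZAhat i.+1 w = gnn_layer rho (psi Ahat) (theta i) (ZAhat i w))
    (hX : (entropy X < +oo)%E) :
  mutual_information (ZA 0%N) (ZAhat 0%N) = entropy X /\
  (forall i, (i <= L)%N ->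
     mutual_information (ZA i) (ZAhat i) \is a fin_num) /\
  (forall i, (i < L)%N ->
     (mutual_information (ZA i.+1) (ZAhat i.+1)
        <= mutual_information (ZA i) (ZAhat i))%E).
Proof.
have I0 : mutual_information (ZA 0%N) (ZAhat 0%N) = entropy X.
  exact: mutual_information_eq.
have step i : (i < L)%N -> (mutual_information (ZA i.+1) (ZAhat i.+1)
    <= mutual_information (ZA i) (ZAhat i))%E.
  move=> iL; apply: mutual_information_comp_le => [||w|w]; last 2 first.
  - exact: hZA.
  - exact: hZAhat.
  - exact: measurable_gnn_layer.
  - exact: measurable_gnn_layer.
split=> //; split=> // i iL.
(* Nonnegativity excludes [-oo], so only the upper bound has to be propagated along the layers. *)
rewrite ge0_fin_numE; last exact: kl_divergence_ge0.
elim: i iL => [_|i IHi iL]; first by rewrite I0.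
exact: le_lt_trans (step _ iL) (IHi (ltnW iL)).
Qed.
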